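(* Let $\phi(t)=(q(t),p(t))$ be a Kepler orbit with energy $H>0$, eccentricity $e>1$ and periapsis at $t=0$, with hyperbolic anomaly $\psi_h(t)$ and hyperbolic mean anomaly $M_h(t)$. Write $S_+(\phi(t))=[(r_0,\bar r),(s_0,\bar s),\sqrt{2H}]$. Then the (hyperbolic) rotation parameter $s_0$ of the map $R_+$ at the point $S_+(\phi(t))$ equals $-\psi_h(t)-M_h(t)$; that is, $s_0(t)=-\psi_h(t)-M_h(t)$ for all $t$.
   Context: The Kepler Hamiltonian is $H(q,p)=\frac12|p|^2-|q|^{-1}$ on $\{(q,p)\in\mathbb R^3\times\mathbb R^3: q\ne0\}$; a Kepler orbit is a solution of $\dot q=p$, $\dot p=-q/|q|^3$. On $\{(q,p): q\ne0,\ H(q,p)>0\}$ define $S_+(q,p)=[(r_0,\bar r),(s_0,\bar s),\sqrt{2H}]$ by $$r_0=|p|^2|q|-1,\quad \bar r=-\sqrt{2H}\,|q|\,p,\quad s_0=-\sqrt{2H}\,\langle q,p\rangle,\quad \bar s=-\Big(\frac{q}{|q|}-\langle q,p\rangle p\Big).$$ The map $R_+$ sends $(r,s,\sqrt{2H})$ to $(x,y)$ given by $$\begin{pmatrix}x_0&\bar x\\ y_0&\bar y\end{pmatrix}=\begin{pmatrix}\cosh(s_0)&-\sinh(s_0)\\ -\frac{\sinh(s_0)}{\sqrt{2H}}&\frac{\cosh(s_0)}{\sqrt{2H}}\end{pmatrix}\begin{pmatrix}r_0&\bar r\\ s_0&\bar s\end{pmatrix},$$ i.e. a hyperbolic rotation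 with parameter $s_0$ followed by scaling the second row by $1/\sqrt{2H}$. For a hyperbolic orbit with $|a|=\frac1{2H}$, eccentricity $e>1$ and periapsis at $t=0$, the hyperbolic anomaly $\psi_h(t)$ (continuous, $\psi_h(0)=0$) and hyperbolic mean anomaly $M_h(t)$ satisfy $|q|=|a|(e\cosh\psi_h-1)$ and $M_h=e\sinh\psi_h-\psi_h=|a|^{-3/2}t$. *)

(* Defs.v *)
From mathcomp Require Import all_boot all_order all_algebra.
From mathcomp Require Import all_classical all_reals all_analysis.

Set Implicit Arguments.
Unset Strict Implicit.
Unset Printing Implicit Defensive.

Import Order.TTheory GRing.Theory Num.Theory.
Import numFieldNormedType.Exports.

Local Open Scope classical_set_scope.
Local Open Scope ring_scope.

Section Kepler.
Context {R : realType}.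
Local Notation vec := 'rV[R]_3.

Implicit Types (q p : vec) (Q P : R -> vec) (h e th t : R) (psi : R -> R).

Definition cosh (x : R) : R := (expR x + expR (- x)) / 2.
Definition sinh (x : R) : R := (expR x - expR (- x)) / 2.

Definition dot (u v : vec) : R := \sum_(i < 3) u 0 i * v 0 i.

(* The library norm `|u| on 'rV[R]_3 is the sup norm, hence this one. *)
Definition enorm (u : vec) : R := Num.sqrt (dot u u).

Definition kepler_H q p : R := enorm p ^+ 2 / 2 - (enorm q)^-1.

(* Derivatives are taken for the sup norm, which is equivalent to enorm. *)
Definition kepler_orbit Q P : Prop :=
  forall t, [/\ Q t != 0,
                is_derive t (1 : R) Q (P t) &
                is_derive t (1 : R) P (- ((enorm (Q t) ^+ 3)^-1 *: Q t))].

(* The Laplace-Runge-Lenz vector p x (q x p) - q / |q|, with the triple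
   product expanded as |p|^2 q - <q, p> p. *)
Definition lrl_vector q p : vec :=
  enorm p ^+ 2 *: q - dot q p *: p - (enorm q)^-1 *: q.

Definition eccentricity q p : R := enorm (lrl_vector q p).

(* Energy and eccentricity are constants of motion, so they are read off the
   state at time 0. *)
Definition orbit_energy Q P : R := kepler_H (Q 0) (P 0).
Definition orbit_eccentricity Q P : R := eccentricity (Q 0) (P 0).

Definition periapsis_at0 Q : Prop := forall t, enorm (Q 0) <= enorm (Q t).

(* |a| as a function of the energy; a itself is negative when h > 0. *)
Definition abs_semimajor h : R := (2 * h)^-1.

Definition hyp_mean_anomaly h t : R := abs_semimajor h `^ (- (3 / 2)) * t.

(* The radius equation leaves the sign of psi free; Kepler's equation fixes
   it (psi t has the sign of t when 1 < e). *)
Definition is_hyp_anomaly Q h e psi : Prop :=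
  [/\ continuous psi,
      psi 0 = 0,
      forall t, enorm (Q t) = abs_semimajor h * (e * cosh (psi t) - 1) &
      forall t, e * sinh (psi t) - psi t = hyp_mean_anomaly h t].

(* A point [(r0, rbar), (s0, sbar), w], where w stands for sqrt (2H). *)
Record rs_point := RSPoint {
  rs_r0 : R; rs_rbar : vec;
  rs_s0 : R; rs_sbar : vec;
  rs_w : R }.

(* Meaningful for q != 0 and kepler_H q p > 0. *)
Definition S_plus q p : rs_point :=
  let w := Num.sqrt (2 * kepler_H q p) in
  {| rs_r0 := enorm p ^+ 2 * enorm q - 1;
     rs_rbar := - ((w * enorm q) *: p);
     rs_s0 := - (w * dot q p);
     rs_sbar := - ((enorm q)^-1 *: q - dot q p *: p);
     rs_w := w |}.

Definition hyp_rotation th : 'M[R]_(1 + 1) :=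
  block_mx (cosh th)%:M (- sinh th)%:M
           (- sinh th)%:M (cosh th)%:M.

Definition scale_second_row (w : R) : 'M[R]_(1 + 1) :=
  block_mx 1%:M 0 0 w^-1%:M.

Definition rs_matrix (z : rs_point) : 'M[R]_(1 + 1, 1 + 3) :=
  block_mx (rs_r0 z)%:M (rs_rbar z)
           (rs_s0 z)%:M (rs_sbar z).

Definition rotation_parameter (z : rs_point) : R := rs_s0 z.

(* The result is the matrix with rows (x0, xbar) and (y0, ybar). *)
Definition R_plus (z : rs_point) : 'M[R]_(1 + 1, 1 + 3) :=
  scale_second_row (rs_w z) *m hyp_rotation (rotation_parameter z)
    *m rs_matrix z.

End Kepler.

Arguments rs_point R : clear implicits.

(* Main.v *)
(** Along the orbit [r = |q|] has derivative [<q, p> / r]. The hyperbolic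
    anomaly is differentiable by the inverse function theorem applied to
    Kepler's equation, and with [w = sqrt (2 H)] its derivative is [w / r].
    Differentiating [r = |a| (e cosh psi - 1)] therefore gives
    [w <q, p> = e sinh psi], which equals [psi + M] by Kepler's equation. *)
Require Import Defs.
From mathcomp Require Import all_boot all_order all_algebra.
From mathcomp Require Import all_classical all_reals all_analysis.
From mathcomp Require Import ring.
Import Order.TTheory GRing.Theory Num.Theory.
Import numFieldNormedType.Exports.
Local Open Scope ring_scope.

Section EuclideanProduct.
Context {R : realType}.
Implicit Types (u v : 'rV[R]_3) (f g : R -> 'rV[R]_3).

Lemma dotC u v : dot u v = dot v u.
Proof. by apply: eq_bigr => i _; rewrite mulrC. Qed.

Lemma dotNr u v : dot u (- v) = - dot u v.
Proof. by rewrite -sumrN; apply: eq_bigr => i _; rewrite mxE mulrN. Qed.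

Lemma dotZr u (k : R) v : dot u (k *: v) = k * dot u v.
Proof. by rewrite mulr_sumr; apply: eq_bigr => i _; rewrite mxE mulrCA. Qed.

Lemma dot_ge0 u : 0 <= dot u u.
Proof. by apply: sumr_ge0 => i _; rewrite -expr2 sqr_ge0. Qed.

Lemma dot_gt0 u : u != 0 -> 0 < dot u u.
Proof.
move=> u0; rewrite lt_def dot_ge0 andbT; apply: contraNneq u0 => /eqP.
rewrite psumr_eq0 => [/allP u0|i _]; last by rewrite -expr2 sqr_ge0.
apply/eqP/rowP => i; rewrite mxE; apply/eqP.
by have := u0 i (mem_index_enum i); rewrite mulf_eq0 orbb.
Qed.

Lemma enorm_sqr u : enorm u ^+ 2 = dot u u.
Proof. by rewrite sqr_sqrtr// dot_ge0. Qed.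

Lemma enorm_gt0 u : u != 0 -> 0 < enorm u.
Proof. by move=> /dot_gt0; rewrite sqrtr_gt0. Qed.

Lemma is_derive_coord f (t : R) (df : 'rV[R]_3) i :
  is_derive t (1 : R) f df -> is_derive t (1 : R) (fun x => f x 0 i) (df 0 i).
Proof.
case=> fD <-; apply: DeriveDef; first exact: (derivable_mxP f t 1).1.
by rewrite derive_mx// mxE.
Qed.

Lemma is_derive_dot f g (t : R) (df dg : 'rV[R]_3) :
  is_derive t (1 : R) f df -> is_derive t (1 : R) g dg ->
  is_derive t (1 : R) (fun x => dot (f x) (g x)) (dot df (g t) + dot (f t) dg).
Proof.
move=> fD gD.
(* The sum and product are lifted to the algebra of functions, the shape on which the
   differentiation rules act. *)
have -> : (fun x => dot (f x) (g x)) =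
    \sum_(i < 3) ((fun x => f x 0 i) * (fun x => g x 0 i)).
  by apply/funext => x; rewrite fct_sumE.
apply: is_derive_eq.
  apply: is_derive_sum => i; apply: is_deriveM; exact: is_derive_coord.
rewrite -big_split/=; apply: eq_bigr => i _.
by rewrite addrC /GRing.scale/=; congr (_ + _); rewrite mulrC.
Qed.

(** Chain rule for the square root of [dot (f x) (f x)]; the square root is differentiable only at
    positive arguments, hence the condition [f t != 0]. *)
Lemma is_derive_enorm f (t : R) (df : 'rV[R]_3) :
  f t != 0 -> is_derive t (1 : R) f df ->
  is_derive t (1 : R) (fun x => enorm (f x)) (dot (f t) df / enorm (f t)).
Proof.
move=> ft0 fD; have n0 := enorm_gt0 _ ft0.
have dD := is_derive_dot _ _ _ _ _ fD fD.
have sD := is_derive1_sqrt (dot_gt0 _ ft0).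
have -> : (fun x => enorm (f x)) = Num.sqrt \o (fun x => dot (f x) (f x)) by [].
apply: is_derive_eq; rewrite -/(enorm _) (dotC df); field.
by rewrite gt_eqF.
Qed.

End EuclideanProduct.

Section Hyperbolic.
Context {R : realType}.
Implicit Types (x y e : R).

Lemma cosh_ge1 x : 1 <= Defs.cosh x.
Proof.
rewrite /Defs.cosh expRN ler_pdivlMr// mul1r.
have x0 := expR_gt0 x; rewrite -subr_ge0.
have -> : expR x + (expR x)^-1 - 2 = (expR x - 1) ^+ 2 / expR x.
  by field; rewrite gt_eqF.
by rewrite divr_ge0 ?sqr_ge0 ?ltW.
Qed.

Lemma is_derive_expRN x :
  is_derive x (1 : R) (fun y => expR (- y)) (- expR (- x)).
Proof.
have -> : (fun y => expR (- y)) = expR \o -%R by [].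
by apply: is_derive_eq; rewrite mulrN1.
Qed.

Lemma is_derive_cosh x : is_derive x (1 : R) (@Defs.cosh R) (Defs.sinh x).
Proof.
have eD := is_derive_expRN x.
have -> : @Defs.cosh R = 2^-1 \*: (expR + (fun y => expR (- y))).
  by apply/funext => y; rewrite /Defs.cosh /= mulrC.
by apply: is_derive_eq; rewrite /GRing.scale/= mulrC.
Qed.

Lemma is_derive_sinh x : is_derive x (1 : R) (@Defs.sinh R) (Defs.cosh x).
Proof.
have eD := is_derive_expRN x.
have -> : @Defs.sinh R = 2^-1 \*: (expR - (fun y => expR (- y))).
  by apply/funext => y; rewrite /Defs.sinh /= mulrC.
by apply: is_derive_eq; rewrite /GRing.scale/= mulrC opprK.
Qed.

Lemma is_derive_kepler e x :
  is_derive x (1 : R) (fun y => e * Defs.sinh y - y) (e * Defs.cosh x - 1).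
Proof.
have sD := is_derive_sinh x.
have -> : (fun y => e * Defs.sinh y - y) = e \*: @Defs.sinh R - id by [].
by apply: is_derive_eq; rewrite /GRing.scale/=.
Qed.

Lemma kepler_derivative_gt0 e x : 1 < e -> 0 < e * Defs.cosh x - 1.
Proof.
move=> e1; rewrite subr_gt0 (lt_le_trans e1)// ler_peMr ?cosh_ge1//.
by rewrite ltW// (lt_trans _ e1).
Qed.

Lemma continuous_kepler e : continuous (fun y : R => e * Defs.sinh y - y).
Proof.
move=> x; apply/differentiable_continuous/derivable1_diffP.
by have [] := is_derive_kepler e x.
Qed.

(** The derivative [e * cosh z - 1] is positive for [1 < e], so the mean value theorem gives strict
    monotonicity. *)
Lemma kepler_inj e : 1 < e -> injective (fun y => e * Defs.sinh y - y).
Proof.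
move=> e1; suff lt x y : x < y -> e * Defs.sinh x - x < e * Defs.sinh y - y.
  by move=> x y /= fxy; have [/lt|/lt|//] := ltgtP x y; rewrite fxy ltxx.
move=> xy; rewrite -subr_gt0.
have [|z _ ->] := @MVT R _ _ _ _ xy (fun z _ => is_derive_kepler e z).
  exact/continuous_subspaceT/continuous_kepler.
by rewrite mulr_gt0 ?kepler_derivative_gt0 ?subr_gt0.
Qed.

(** Differentiability of [psi] is derived, not assumed: Kepler's equation makes [psi] a right
    inverse of a smooth injective function, hence a two-sided inverse, and the inverse function
    theorem applies. *)
Lemma is_derive_kepler_solution e (n : R) (psi : R -> R) (t : R) :
  1 < e -> n != 0 -> (forall s, e * Defs.sinh (psi s) - psi s = n * s) ->
  is_derive t (1 : R) psi (n / (e * Defs.cosh (psi t) - 1)).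
Proof.
move=> e1 n0 psiE.
pose f : R -> R := n^-1 \*: (fun y => e * Defs.sinh y - y).
have fpsi s : f (psi s) = s by rewrite /f/= psiE /GRing.scale/= mulKf.
have psif x : psi (f x) = x.
  apply: (kepler_inj e e1) => /=.
  by rewrite psiE /f/= /GRing.scale/= mulVKf.
have fD x : is_derive x (1 : R) f (n^-1 * (e * Defs.cosh x - 1)).
  exact: (@is_deriveZ _ _ _ _ _ _ _ _ (is_derive_kepler e x)).
have := kepler_derivative_gt0 e (psi t) e1; rewrite lt0r => /andP[k0 _].
(* The base point becomes [f (psi t)] and the value the inverse of the derivative of [f] at [psi t],
   as in the inverse function theorem. *)
rewrite -{1}(fpsi t) -[n in n / _]invrK -invfM.
apply: (@is_derive_inverse _ f).
- exact: filterE psif.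
- apply: filterE => x; apply/differentiable_continuous/derivable1_diffP.
  by have [] := fD x.
- by rewrite mulf_neq0 ?invr_eq0.
Qed.

End Hyperbolic.

(** The kinetic term has derivative [- <q, p> / |q|^3] by the equation of motion, which cancels that
    of [- |q|^-1]. *)
Lemma kepler_energy_conserved (R : realType) (q p : R -> 'rV[R]_3) :
  kepler_orbit q p -> forall t, kepler_H (q t) (p t) = kepler_H (q 0) (p 0).
Proof.
move=> orbit t; apply: (@is_derive_0_is_cst R (fun s => kepler_H (q s) (p s))).
move=> s; have [q0 qD pD] := orbit s.
have n0 := enorm_gt0 _ q0.
have ppD := is_derive_dot _ _ _ _ _ pD pD.
have rD := is_derive_enorm _ _ _ q0 qD.
have iD := @is_deriveV R (fun x => enorm (q x)) s _ 1 (lt0r_neq0 n0) rD.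
have -> : (fun x => kepler_H (q x) (p x)) =
    2^-1 \*: (fun x => dot (p x) (p x)) - (fun x => (enorm (q x))^-1).
  by apply/funext => x; rewrite /kepler_H enorm_sqr /= mulrC.
apply: is_derive_eq; rewrite /GRing.scale/=.
rewrite (dotC _ (p s)) dotNr dotZr (dotC (p s)); field.
by rewrite gt_eqF.
Qed.

(** Turns the real power into an integer power of [w = sqrt (2 h)], so that the final identity is
    rational in [w]. *)
Lemma hyp_mean_motionE (R : realType) (h : R) : 0 < h ->
  abs_semimajor h `^ (- (3 / 2)) = Num.sqrt (2 * h) ^+ 3.
Proof.
move=> h0; have h20 : 0 < 2 * h by rewrite mulr_gt0.
rewrite /abs_semimajor -powR_inv1 ?ltW// -powRrM -powR12_sqrt ?ltW//.
by rewrite -powR_mulrn ?powR_ge0// -powRrM; congr (_ `^ _); field.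
Qed.

Theorem theorem5p11 (R : realType) (q p : R -> 'rV[R]_3) (h e : R)
    (psi : R -> R)
    (orbit : kepler_orbit q p)
    (energy : orbit_energy q p = h) (h_gt0 : 0 < h)
    (ecc : orbit_eccentricity q p = e) (e_gt1 : 1 < e)
    (periapsis : periapsis_at0 q)
    (anomaly : is_hyp_anomaly q h e psi) :
  forall t : R,
    rotation_parameter (S_plus (q t) (p t)) = - psi t - hyp_mean_anomaly h t.
Proof.
move=> t; have [_ _ rE psiE] := anomaly.
rewrite /rotation_parameter/= (kepler_energy_conserved _ _ _ orbit).
rewrite -/(orbit_energy q p) energy.
(* By Kepler's equation the right side is [- (e * sinh (psi t))]; what remains is
   [w <q, p> = e sinh psi]. *)
rewrite -psiE opprB addKr.
have [q0 qD _] := orbit t.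
set w := Num.sqrt (2 * h).
have w0 : 0 < w by rewrite sqrtr_gt0 mulr_gt0.
have aE : abs_semimajor h = w ^- 2 by rewrite sqr_sqrtr// mulr_ge0// ltW.
have psiD : is_derive t (1 : R) psi (w ^+ 3 / (e * Defs.cosh (psi t) - 1)).
  apply: is_derive_kepler_solution => // [|s].
    by rewrite expf_neq0 ?gt_eqF.
  by rewrite psiE /hyp_mean_anomaly hyp_mean_motionE.
have k0 := kepler_derivative_gt0 e (psi t) e_gt1.
have coshD := is_derive_cosh (psi t).
have [_ rD] := is_derive_enorm _ _ _ q0 qD.
(* A second computation of the derivative of [|q|], now through the anomaly; uniqueness of the
   derivative equates it with [<q, p> / |q|]. *)
have rD' : is_derive t (1 : R) (fun x => enorm (q x))
    (w ^- 2 * (e * (Defs.sinh (psi t) *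
                    (w ^+ 3 / (e * Defs.cosh (psi t) - 1))))).
  have -> : (fun x => enorm (q x)) =
      w ^- 2 \*: (e \*: (@Defs.cosh R \o psi) - cst 1).
    by apply/funext => x; rewrite rE aE.
  by apply: is_derive_eq; rewrite /GRing.scale/= subr0.
have := @derive_val _ _ _ _ _ _ _ rD'; rewrite rD rE aE => dE.
have {dE} : dot (q t) (p t) = w^-1 * (e * Defs.sinh (psi t)).
  (* This is [|q|] in terms of the anomaly; multiplying by it cancels the factor [e cosh psi - 1]
     and leaves [w^-2 * w^3 * w^-2 = w^-1]. *)
  have n0 : w ^- 2 * (e * Defs.cosh (psi t) - 1) != 0.
    by rewrite mulf_neq0 ?invr_eq0 ?expf_neq0 ?gt_eqF.
  rewrite -(divfK n0 (dot _ _)) dE; field.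
  by rewrite !gt_eqF.
by move=> ->; rewrite mulVKf ?gt_eqF.
Qed.
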